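(* The quantities $\alpha_n(\mathbf{a},\mathbf{a})$, $\alpha_n(\mathbf{a},\mathbf{b})$, $\alpha_n(\mathbf{b},\mathbf{b})$ and $\alpha_n$ are given by the explicit expressions $$\begin{aligned}\alpha_n(\mathbf{a},\mathbf{a})&=\left\lfloor (e-4+4/e)\cdot n!\right\rceil&&\text{for }n\ge8,\\ \alpha_n(\mathbf{a},\mathbf{b})&=\left\lfloor(1-2/e)\cdot n!\right\rceil&&\text{for }n\ge3,\\ \alpha_n(\mathbf{b},\mathbf{b})&=\left\lfloor \tfrac1e\cdot n!\right\rceil&&\text{for }n\ge2,\\ \alpha_n&=\left\lfloor(e-2+1/e)\cdot n!\right\rceil&&\text{for }n\ge4.\end{aligned}$$
   Context: $\lfloor x\rceil$ denotes the nearest integer to $x$. The descent word of a permutation $\pi=\pi_1\cdots\pi_n\in\mathfrak{S}_n$ is $u(\pi)=u_1\cdots u_{n-1}$, with $u_i=\mathbf{a}$ if $\pi_i<\pi_{i+1}$ and $u_i=\mathbf{b}$ if $\pi_i>\pi_{i+1}$. Set $\mathrm{wt}(\mathbf{aa})=0$, $\mathrm{wt}(\mathbf{bb})=2$, $\mathrm{wt}(\mathbf{ab})=\mathrm{wt}(\mathbf{ba})=1$, and $\mathrm{Wt}(\pi)=\prod_{i=1}^{n-2}\mathrm{wt}(u_iu_{i+1})$ (an empty product is $1$). For $n\ge2$, $\alpha_n=\sum_{\pi\in\mathfrak{S}_n}\mathrm{Wt}(\pi)$, and for $x,y\in\{\mathbf{a},\mathbf{b}\}$, $\alpha_n(x,y)=\sum\mathrm{Wt}(\pi)$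 over all $\pi\in\mathfrak{S}_n$ whose descent word begins with the letter $x$ and ends with the letter $y$. *)

(* Defs.v *)
From HB Require Import structures.
From mathcomp Require Import all_boot all_order all_algebra all_fingroup.
From mathcomp Require Import reals.

Set Implicit Arguments.
Unset Strict Implicit.
Unset Printing Implicit Defensive.

Import GRing.Theory Num.Theory.

Inductive letter : Type := La | Lb.

Definition letter_to_bool (x : letter) : bool :=
  if x is Lb then true else false.
Definition letter_of_bool (c : bool) : letter := if c then Lb else La.

Lemma letter_to_boolK : cancel letter_to_bool letter_of_bool.
Proof. by case. Qed.

HB.instance Definition _ := Equality.copy letter (can_type letter_to_boolK).

Definition adjacent_pairs (T : Type) (s : seq T) : seq (T * T) :=
  zip s (behead s).

(* The values are numbered from 0 instead of from 1; only their relative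
   order matters. *)
Definition one_line (n : nat) (p : 'S_n) : seq nat :=
  [seq val (p i) | i <- enum 'I_n].

Definition descent_word (n : nat) (p : 'S_n) : seq letter :=
  [seq if (xy.1 < xy.2)%N then La else Lb | xy <- adjacent_pairs (one_line p)].

Definition wt (x y : letter) : nat :=
  match x, y with
  | La, La => 0
  | Lb, Lb => 2
  | La, Lb | Lb, La => 1
  end.

Definition Wt (n : nat) (p : 'S_n) : nat :=
  (\prod_(xy <- adjacent_pairs (descent_word p)) wt xy.1 xy.2)%N.

Definition begins_with (x : letter) (u : seq letter) : bool :=
  ohead u == Some x.
Definition ends_with (y : letter) (u : seq letter) : bool :=
  ohead (rev u) == Some y.

Definition alpha (n : nat) : nat := (\sum_(p : 'S_n) Wt p)%N.

Definition alpha_xy (n : nat) (x y : letter) : nat :=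
  (\sum_(p : 'S_n | begins_with x (descent_word p)
                    && ends_with y (descent_word p)) Wt p)%N.

(* A tie is rounded up. *)
Definition nearest_int (R : realType) (x : R) : int :=
  Num.floor (x + 2^-1)%R.

(* Main.v *)
Require Import Defs.
From HB Require Import structures.
From mathcomp Require Import all_boot all_order all_algebra all_fingroup.
From mathcomp Require Import classical_sets reals topology normedtype.
From mathcomp Require Import sequences exp.
From mathcomp Require Import zify ring lra.

Set Implicit Arguments.
Unset Strict Implicit.
Unset Printing Implicit Defensive.

Import Order.TTheory GRing.Theory Num.Theory numFieldNormedType.Exports.
Local Open Scope ring_scope.

(* Record only the last value j of a permutation and its last letter, the first
   letter being fixed. Deleting the last entry gives, for the weighted counts
   a_n(j) and b_n(j) with last letter a and b,
     a_{n+1}(j) = sum_{i < j} b_n(i),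
     b_{n+1}(j) = sum_{i >= j} (a_n(i) + 2 b_n(i)).
   Hence c_n = a_n + b_n satisfies c_{n+1}(j+1) = c_{n+1}(j) - c_n(j): the c_n
   are the rows of the difference table of a sequence u, the one with
   u_{n+1} = (n+1) u_n + d, and b_n(j) = (n-1-j) c_{n-1}(j) + d [j = 0].
   For first letter b one gets u_n = n!, d = 0, and for first letter a
   u_n = sum_{k <= n} n!/k! - 2 n!, d = 1. The counts with last letter b sum to
   the diagonal entry of the table, those with last letter a to u_n minus twice
   it; the diagonals are the derangement numbers D_n and n! - 2 D_n. It remains
   to estimate n! times the tails of the series of e and 1/e. *)

(** * Appending a last entry to a permutation *)

Lemma adjacent_pairs_rcons (T : Type) (s : seq T) (x0 y : T) :
  (0 < size s)%N ->
  adjacent_pairs (rcons s y) = rcons (adjacent_pairs s) (last x0 s, y).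
Proof.
rewrite /adjacent_pairs; case: s => // x s _ /=.
by elim: s x => [|z s IH] x //=; rewrite IH.
Qed.

Lemma adjacent_pairs_map (T U : Type) (f : T -> U) (s : seq T) :
  adjacent_pairs (map f s) = [seq (f xy.1, f xy.2) | xy <- adjacent_pairs s].
Proof.
rewrite /adjacent_pairs; case: s => // x s /=.
by elim: s x => [|z s IH] x //=; rewrite IH.
Qed.

Lemma size_one_line (n : nat) (p : 'S_n) : size (one_line p) = n.
Proof. by rewrite size_map size_enum_ord. Qed.

Lemma size_descent_word (n : nat) (p : 'S_n) : size (descent_word p) = n.-1.
Proof.
rewrite size_map size_zip size_behead size_one_line.
exact/minn_idPr/leq_pred.
Qed.

Lemma one_line_lift (n : nat) (j : 'I_n.+1) (s : 'S_n) :
  one_line (lift_perm ord_max j s) = rcons (map (bump j) (one_line s)) j.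
Proof.
rewrite /one_line enum_ordSr map_rcons lift_perm_id -!map_comp; congr rcons.
apply: eq_map => i /=.
have -> : widen_ord (leqnSn n) i = lift ord_max i.
  exact/val_inj/esym/lift_max.
by rewrite lift_perm_lift.
Qed.

(** [bump j] is strictly increasing, so the old letters survive; a bumped last value lies below [j]
    exactly when the old one does. *)
Lemma descent_word_lift (n : nat) (j : 'I_n.+2) (s : 'S_n.+1) :
  descent_word (lift_perm ord_max j s) =
  rcons (descent_word s) (if (last 0%N (one_line s) < j)%N then La else Lb).
Proof.
rewrite /descent_word one_line_lift.
have sz : (0 < size (map (bump j) (one_line s)))%N.
  by rewrite size_map size_one_line.
rewrite (adjacent_pairs_rcons (bump j 0) _ sz) map_rcons last_map.
rewrite adjacent_pairs_map -map_comp; congr rcons.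
  by apply: eq_map => -[x y] /=; rewrite ltnNge leq_bump2 -ltnNge.
by case: (last _ _) => [|l] /=; congr (if _ then _ else _); rewrite /bump; lia.
Qed.

Lemma Wt_lift (n : nat) (j : 'I_n.+3) (s : 'S_n.+2) :
  Wt (lift_perm ord_max j s) =
  (Wt s * wt (last La (descent_word s))
             (if last 0%N (one_line s) < j then La else Lb))%N.
Proof.
rewrite /Wt descent_word_lift (adjacent_pairs_rcons La) ?size_descent_word //.
by rewrite big_rcons.
Qed.

Lemma sum_perm_lift (V : nmodType) (n : nat) (F : 'S_n.+1 -> V) :
  \sum_p F p = \sum_(s : 'S_n) \sum_(j < n.+1) F (lift_perm ord_max j s).
Proof.
rewrite pair_big /= (reindex (fun sj => lift_perm ord_max sj.2 sj.1)) //.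
(* Surjectivity comes from counting: (n+1)! = n! (n+1). *)
apply/onW_bij/inj_card_bij; last first.
  by rewrite card_prod !card_Sn card_ord factS mulnC.
move=> [s j] [s' j'] /= eq_lift.
have eqj : j = j' by rewrite -(lift_perm_id ord_max j s) eq_lift lift_perm_id.
congr (_, _) => //; apply/permP => i; apply: (@lift_inj _ j).
by rewrite -(lift_perm_lift ord_max) eq_lift lift_perm_lift eqj.
Qed.

(** * Counts by last value and last letter *)

Definition last_letter_sum (n : nat) (x : letter)
    (phi : nat -> letter -> int) : int :=
  \sum_(p : 'S_n | begins_with x (descent_word p))
     (Wt p)%:R * phi (last 0%N (one_line p)) (last La (descent_word p)).

(** Appending an entry changes only the test function, which is why [phi] is kept arbitrary: it
    encodes the joint distribution of last value and last letter. *)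
Lemma last_letter_sumS (n : nat) (x : letter) (phi : nat -> letter -> int) :
  last_letter_sum n.+3 x phi =
  last_letter_sum n.+2 x (fun i y =>
    \sum_(j < n.+3) if (i < j)%N then (wt y La)%:R * phi j La
                    else (wt y Lb)%:R * phi j Lb).
Proof.
rewrite /last_letter_sum big_mkcond sum_perm_lift [RHS]big_mkcond /=.
apply: eq_bigr => s _; set w := descent_word s.
have bw (j : 'I_n.+3) : begins_with x (descent_word (lift_perm ord_max j s))
    = begins_with x w.
  rewrite descent_word_lift -/w.
  have : (0 < size w)%N by rewrite size_descent_word.
  by case: w.
case: ifP => bws; last by rewrite big1 // => j _; rewrite bw bws.
rewrite big_distrr /=; apply: eq_bigr => j _.
rewrite bw bws Wt_lift descent_word_lift one_line_lift !last_rcons -/w.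
by case: ifP => _; rewrite natrM mulrA.
Qed.

(* Meaningful only for j <= m, where m.-1 is never the predecessor of 0. *)
Fixpoint difference_table (u : nat -> int) (j m : nat) : int :=
  if j is i.+1 then difference_table u i m - difference_table u i m.-1
  else u m.

(* With u and d as in [last_letter_sumE]: the weighted number of permutations
   of length k + 2 with a given first letter, last letter b and last value j. *)
Definition last_b_count (u : nat -> int) (d : int) (k j : nat) : int :=
  (k.+1%:R - j%:R) * difference_table u j k + d *+ (j == 0%N).

Lemma last_b_count_diff u d k j :
  last_b_count u d k.+1 j - last_b_count u d k.+1 j.+1 =
  difference_table u j k.+1 + last_b_count u d k j.
Proof.
rewrite /last_b_count /= mulr0n addr0.
move: (difference_table _ _ _) (difference_table _ _ _) (d *+ _) => t t' r.
by rewrite -[in k.+2%:R]natr1 -[in j.+1%:R]natr1; ring.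
Qed.

(** A table entry is a_n + b_n, so the summand is a_n + 2 b_n. It telescopes by [last_b_count_diff],
    and the upper boundary term has the factor (k+2) - (k+2). *)
Lemma sum_last_b_ge u d k j : (j <= k.+2)%N ->
  \sum_(i < k.+2 | (j <= i)%N)
     (difference_table u i k.+1 + last_b_count u d k i)
  = last_b_count u d k.+1 j.
Proof.
move=> le_jk.
rewrite -(big_geq_mkord j k.+2 xpredT
  (fun i => difference_table u i k.+1 + last_b_count u d k i)).
under eq_bigr => i _ do rewrite -last_b_count_diff -opprB.
rewrite sumrN telescope_sumr // opprB {2}/last_b_count.
by rewrite subrr mul0r add0r subr0.
Qed.

Lemma sum_last_b_lt u d k j : (forall m, u m.+1 = m.+1%:R * u m + d) ->
  (j <= k.+2)%N ->
  \sum_(i < k.+2 | (i < j)%N) last_b_count u d k i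
  = difference_table u j k.+2 - last_b_count u d k.+1 j.
Proof.
move=> uS le_jk.
rewrite -(big_ord_widen _ (last_b_count u d k)) // -(big_mkord xpredT).
pose f i := difference_table u i k.+2 - last_b_count u d k.+1 i.
rewrite (eq_bigr (fun i => f i.+1 - f i)) => [|i _]; last first.
  have /eqP := last_b_count_diff u d k i.
  rewrite /f /= subr_eq => /eqP ->; ring.
(* The recurrence of [u] says exactly that the boundary term [f 0] vanishes. *)
rewrite telescope_sumr // {2}/f /last_b_count /= uS subr0 mulr1n.
by rewrite subrr subr0.
Qed.

Lemma last_letter_sumE (x : letter) (u : nat -> int) (d : int) :
  (forall m, u m.+1 = m.+1%:R * u m + d) ->
  (forall phi, last_letter_sum 2 x phi = \sum_(j < 2)
     ((difference_table u j 1 - last_b_count u d 0 j) * phi j La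
      + last_b_count u d 0 j * phi j Lb)) ->
  forall k phi, last_letter_sum k.+2 x phi = \sum_(j < k.+2)
     ((difference_table u j k.+1 - last_b_count u d k j) * phi j La
      + last_b_count u d k j * phi j Lb).
Proof.
move=> uS base; elim=> [|k IH] phi; first exact: base.
rewrite last_letter_sumS IH.
under eq_bigr => i _ do rewrite !big_distrr -big_split /=.
rewrite exchange_big /=; apply: eq_bigr => j _.
have le_jk : (j <= k.+2)%N by rewrite -ltnS.
rewrite -(sum_last_b_lt uS le_jk) -(sum_last_b_ge u d le_jk).
rewrite !big_distrl /= [in RHS]big_mkcond [X in _ + X]big_mkcond -big_split /=.
apply: eq_bigr => i _; rewrite ltnNge; case: leqP => _ /=.
  by rewrite add0r; ring.
by rewrite addr0; ring.
Qed.

Lemma last_letter_sum2 (x : letter) (phi : nat -> letter -> int) :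
  last_letter_sum 2 x phi = if x is La then phi 1%N La else phi 0%N Lb.
Proof.
rewrite /last_letter_sum big_mkcond sum_perm_lift.
have one_line1 (s : 'S_1) : one_line s = [:: 0%N].
  by rewrite /one_line enum_ordSl enum_ord0 /= ord1.
under eq_bigr => s _.
  rewrite 2!big_ord_recl big_ord0 /= /Wt !descent_word_lift !one_line_lift.
  rewrite /descent_word !one_line1 /= /begins_with /adjacent_pairs /= big_nil.
  over.
rewrite sumr_const card_Sn.
by case: x => /=; rewrite ?add0r ?addr0 mul1r.
Qed.

(** * The diagonal of the difference table *)

(* Leibniz rule for the j-th difference of the product (m + 1) u_m. *)
Lemma difference_table_leibniz (u : nat -> int) (d : int) (j m : nat) :
  (forall m, u m.+1 = m.+1%:R * u m + d) -> (j <= m)%N ->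
  difference_table u j m.+1 =
  m.+1%:R * difference_table u j m + j%:R * difference_table u j.-1 m.-1
  + d *+ (j == 0%N).
Proof.
move=> uS; elim: j m => [|j IH] m le_jm /=; first by rewrite uS; ring.
case: m le_jm => // m le_jm /=.
rewrite !IH // ?leqW //= mulr0n.
case: j {IH} le_jm => [|j] le_jm /=; first by ring.
by rewrite -!natr1; ring.
Qed.

(** Differencing kills the constant [d], so every such table has a diagonal obeying the two-step
    recurrence of the derangement numbers. *)
Lemma difference_table_diag (u : nat -> int) (d : int) (m : nat) :
  (forall m, u m.+1 = m.+1%:R * u m + d) ->
  difference_table u m.+2 m.+2 =
  m.+1%:R * (difference_table u m.+1 m.+1 + difference_table u m m).
Proof.
move=> uS; rewrite [LHS]/= -/(difference_table u m.+1 m.+2).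
rewrite (difference_table_leibniz uS) // mulr0n addr0 -[m.+2%:R]natr1 /=.
by ring.
Qed.

(** The one-step recurrence is chosen because it matches that of the remainders of the series of
    1/e. *)
Fixpoint derangements (n : nat) : int :=
  if n is m.+1 then n%:R * derangements m + (-1) ^+ n else 1.

Lemma derangements_rec m :
  derangements m.+2 = m.+1%:R * (derangements m.+1 + derangements m).
Proof. by rewrite /= -[m.+2%:R]natr1 !exprS; ring. Qed.

Lemma difference_table_diag_unique (u : nat -> int) (d : int) (v : nat -> int) :
  (forall m, u m.+1 = m.+1%:R * u m + d) ->
  (forall m, v m.+2 = m.+1%:R * (v m.+1 + v m)) ->
  v 0%N = u 0%N -> v 1%N = u 1%N - u 0%N ->
  forall m, difference_table u m m = v m.
Proof.
move=> uS vS v0 v1 m.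
suff [] : difference_table u m m = v m /\
          difference_table u m.+1 m.+1 = v m.+1 by [].
elim: m => [|m [IH1 IH2]]; first by rewrite v0 v1.
by split=> //; rewrite (difference_table_diag m uS) IH1 IH2 vS.
Qed.

(** * Closed forms of the weighted counts *)

Lemma alpha_xyE (n : nat) (x y : letter) : (2 <= n)%N ->
  (alpha_xy n x y)%:Z = last_letter_sum n x (fun _ z => (z == y)%:R).
Proof.
case: n => [|[|k]] // _; rewrite /alpha_xy /last_letter_sum -natz natr_sum.
rewrite big_mkcondr; apply: eq_bigr => p _; rewrite /ends_with.
have : (0 < size (descent_word p))%N by rewrite size_descent_word.
case/lastP: (descent_word p) => // w z _.
rewrite rev_rcons last_rcons /= (inj_eq Some_inj).
by case: eqP => _; rewrite ?mulr1 ?mulr0.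
Qed.

Lemma alpha_xy_last (x : letter) (u : nat -> int) (d : int) :
  (forall m, u m.+1 = m.+1%:R * u m + d) ->
  (forall phi, last_letter_sum 2 x phi = \sum_(j < 2)
     ((difference_table u j 1 - last_b_count u d 0 j) * phi j La
      + last_b_count u d 0 j * phi j Lb)) ->
  forall n, (2 <= n)%N ->
  (alpha_xy n x Lb)%:Z = difference_table u n n /\
  (alpha_xy n x La)%:Z = u n - 2 * difference_table u n n.
Proof.
move=> uS base [|[|k]] // _; rewrite !alpha_xyE // !(last_letter_sumE uS base).
(* The two partial-sum lemmas at their extreme cuts: at j = k+2 the term [last_b_count] vanishes,
   and at j = 0 it equals u_{k+2}. *)
have sumb : \sum_(j < k.+2) last_b_count u d k j = difference_table u k.+2 k.+2.
  have := sum_last_b_lt uS (leqnn k.+2).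
  rewrite /(last_b_count _ _ k.+1) subrr mul0r mulr0n add0r subr0 => <-.
  by apply: eq_bigl => i; rewrite ltn_ord.
have sumab : \sum_(j < k.+2) (difference_table u j k.+1 + last_b_count u d k j)
             = u k.+2.
  have := sum_last_b_ge u d (leq0n k.+2); rewrite /(last_b_count _ _ k.+1) /=.
  by rewrite subr0 mulr1n -uS.
split.
  by rewrite -sumb; apply: eq_bigr => j _; rewrite mulr0 add0r mulr1.
rewrite -sumab -sumb mulr_sumr -sumrB; apply: eq_bigr => j _.
by rewrite /= mulr0 addr0; ring.
Qed.

(* The sum of the n!/k! over k <= n, minus 2 n!. *)
Fixpoint shifted_arrangements (n : nat) : int :=
  if n is m.+1 then n%:R * shifted_arrangements m + 1 else -1.

Lemma alpha_xy_b n : (2 <= n)%N ->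
  (alpha_xy n Lb Lb)%:Z = derangements n /\
  (alpha_xy n Lb La)%:Z = n`!%:R - 2 * derangements n.
Proof.
pose u m : int := m`!%:R.
have uS m : u m.+1 = m.+1%:R * u m + 0 by rewrite /u factS natrM addr0.
have diag m : difference_table u m m = derangements m.
  exact: (difference_table_diag_unique uS derangements_rec).
rewrite -diag; apply: (alpha_xy_last uS) => phi.
rewrite last_letter_sum2 !big_ord_recl big_ord0 /last_b_count /u /= !fact0.
by rewrite (_ : bump 0 0 = 1%N) // mulr1n mulr0n; ring.
Qed.

Lemma alpha_xy_a n : (2 <= n)%N ->
  (alpha_xy n La Lb)%:Z = n`!%:R - 2 * derangements n /\
  (alpha_xy n La La)%:Z =
    shifted_arrangements n - 2 * (n`!%:R - 2 * derangements n).
Proof.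
have uS m : shifted_arrangements m.+1 = m.+1%:R * shifted_arrangements m + 1.
  by [].
pose v m : int := m`!%:R - 2 * derangements m.
(* Factorials satisfy the same two-step recurrence as derangement numbers. *)
have vS m : v m.+2 = m.+1%:R * (v m.+1 + v m).
  rewrite /v derangements_rec !factS !natrM -[m.+2%:R]natr1.
  by move: (derangements _) (derangements _) => x y; ring.
have diag m : difference_table shifted_arrangements m m = v m.
  exact: (difference_table_diag_unique uS vS).
rewrite -/(v n) -diag; apply: (alpha_xy_last uS) => phi.
rewrite last_letter_sum2 !big_ord_recl big_ord0 /last_b_count /=.
by rewrite (_ : bump 0 0 = 1%N) // mulr1n mulr0n; ring.
Qed.

Lemma alpha_sum n : (2 <= n)%N ->
  alpha n = (alpha_xy n La La + alpha_xy n La Lb +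
             (alpha_xy n Lb La + alpha_xy n Lb Lb))%N.
Proof.
move=> n_gt1; rewrite /alpha /alpha_xy.
rewrite ![(\sum_(p | begins_with _ _ && _) _)%N]big_mkcond -!big_split /=.
apply: eq_bigr => p _.
have : (0 < size (descent_word p))%N.
  by rewrite size_descent_word; case: n n_gt1 p => [|[]].
rewrite /ends_with; case: (descent_word p) (erefl (descent_word p)) => // x w.
rewrite [in ohead (rev _)]lastI => _ _; rewrite rev_rcons /=.
by case: (last x w); case: x; rewrite /begins_with /= ?addn0 ?add0n.
Qed.

(** * Remainders of the exponential series *)

Lemma nearest_int_eq (R : realType) (k : int) (x : R) :
  `|x - k%:~R| < 2^-1 -> k = nearest_int x.
Proof.
rewrite ltr_distl => /andP[ltl ltr]; apply/esym/floor_def.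
by rewrite intrD; apply/andP; split; lra.
Qed.

(* Telescoping: 1 / (k+1)! <= 1 / (k k!) - 1 / ((k+1) (k+1)!). *)
Lemma expR_series_tail (R : realType) (x : R) (n : nat) : `|x| <= 1 ->
  `|expR x - series (exp_coeff x) n.+2| <= (n.+1%:R * n.+1`!%:R)^-1.
Proof.
move=> x_le1; pose c k : R := (k.+1%:R * k.+1`!%:R)^-1.
have c_gt0 k : 0 < c k by rewrite invr_gt0 mulr_gt0 // ltr0n fact_gt0.
have cS k : (k.+2`!%:R)^-1 <= c k - c k.+1.
  rewrite /c !factS !natrM -!natr1.
  have k_ge0 : 0 <= k%:R :> R by [].
  have f_gt0 : 0 < k`!%:R :> R by rewrite ltr0n fact_gt0.
  rewrite -subr_ge0; set y := (X in 0 <= X).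
  have -> : y = ((k%:R + 1) ^+ 2 * (k%:R + 2) ^+ 2 * k`!%:R)^-1.
    by rewrite /y; field; rewrite ?gt_eqF //; lra.
  rewrite invr_ge0; apply: mulr_ge0; last exact: ltW.
  by apply: mulr_ge0; apply: exprn_ge0; lra.
have step m : `|series (exp_coeff x) (n.+2 + m)%N - series (exp_coeff x) n.+2|
    <= c n - c (n + m)%N.
  elim: m => [|m IH]; first by rewrite !addn0 !subrr normr0.
  rewrite !addnS [series _ _]big_nat_recr //= addrAC.
  apply: le_trans (ler_normD _ _) _.
  have coef : `|exp_coeff x (n.+2 + m)%N| <= ((n + m).+2`!%:R)^-1.
    rewrite /exp_coeff normrM normfV normr_nat addSn ler_piMl ?invr_ge0 //.
    by rewrite normrX exprn_ile1.
  by have := le_trans coef (cS _); move: IH; rewrite /series /=; lra.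
have cvgS : ((fun m => `|series (exp_coeff x) m - series (exp_coeff x) n.+2|)
    @ \oo --> `|expR x - series (exp_coeff x) n.+2|)%classic.
  apply: cvg_norm; apply: cvgB; last exact: cvg_cst.
  exact: is_cvg_series_exp_coeff.
rewrite -(cvg_lim _ cvgS) //.
apply: limr_le; first by apply/cvg_ex; eexists; exact: cvgS.
exists n.+2 => // m /= le_nm; rewrite -(subnKC le_nm).
by apply: le_trans (step _) _; rewrite gerBl ltW.
Qed.

Definition exp_remainder (R : realType) (x : R) (n : nat) : R :=
  n`!%:R * (expR x - series (exp_coeff x) n.+1).

Lemma exp_remainderS (R : realType) (x : R) (n : nat) :
  n.+1%:R * exp_remainder x n = exp_remainder x n.+1 + x ^+ n.+1.
Proof.
rewrite /exp_remainder [series _ n.+2]big_nat_recr //= mulrA -natrM -factS.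
rewrite opprD addrA [in RHS]mulrDr mulrN /exp_coeff /= mulrCA.
by rewrite mulfV ?mulr1 ?subrK // pnatr_eq0 -lt0n fact_gt0.
Qed.

Lemma exp_remainder_le (R : realType) (x : R) (n : nat) : `|x| <= 1 ->
  `|exp_remainder x n.+1| <= n.+1%:R^-1.
Proof.
move=> x_le1; rewrite /exp_remainder normrM normr_nat.
have f_gt0 : 0 < n.+1`!%:R :> R by rewrite ltr0n fact_gt0.
by rewrite mulrC -ler_pdivlMr // -invfM expR_series_tail.
Qed.

Lemma exp_remainder0 (R : realType) (x : R) : exp_remainder x 0 = expR x - 1.
Proof.
by rewrite /exp_remainder [series _ _]big_nat1 /exp_coeff /= expr0 divr1 mul1r.
Qed.

(** By [exp_remainderS] the sum of [derangements] and the remainder is multiplied by n+1 at each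
    step, so it is n! times its initial value 1/e. The next lemma is alike, with initial value e -
    2. *)
Lemma derangementsE (R : realType) n :
  (derangements n)%:~R = n`!%:R * expR (-1) - exp_remainder (-1) n :> R.
Proof.
elim: n => [|n IH]; first by rewrite exp_remainder0 mul1r opprB addrC subrK.
rewrite [derangements _]/= intrD intrM rmorph_nat IH.
have := exp_remainderS (-1 : R) n; rewrite factS natrM rmorphXn /= => eqS.
by rewrite mulrBr eqS; ring.
Qed.

Lemma shifted_arrangementsE (R : realType) n :
  (shifted_arrangements n)%:~R =
  n`!%:R * (expR 1 - 2) - exp_remainder 1 n :> R.
Proof.
elim: n => [|n IH]; first by rewrite exp_remainder0 rmorphN1 fact0; ring.
rewrite [shifted_arrangements _]/= intrD intrM rmorph_nat IH.
have := exp_remainderS (1 : R) n; rewrite factS natrM expr1n => eqS.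
by rewrite mulrBr eqS; ring.
Qed.

(** In (m+1) r_m = r_{m+1} + 1 the remainder on the right is less than 1 in absolute value. *)
Lemma exp_remainder1_gt0 (R : realType) n : 0 < exp_remainder (1 : R) n.+1.
Proof.
have := @exp_remainder_le R 1 n.+1; rewrite normr1 lexx => /(_ isT).
have := exp_remainderS (1 : R) n.+1; rewrite expr1n.
have : n.+2%:R^-1 < 1 :> R by rewrite invf_lt1 ?ltr1n ?ltr0n.
rewrite ler_norml => h1 h2 /andP[h3 _].
rewrite -(pmulr_rgt0 _ (ltr0Sn R n.+1)) h2.
by move: (n.+2%:R^-1) h1 h3 => y; lra.
Qed.

(* The signed remainder satisfies (m + 1) s_m = 1 - s_(m+1). *)
Lemma alternating_remainder (R : realType) n :
  0 < (-1) ^+ n.+2 * exp_remainder (-1 : R) n.+1 < n.+2%:R^-1.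
Proof.
pose s m := (-1) ^+ m.+1 * exp_remainder (-1 : R) m.
have s_le m : `|s m.+1| <= m.+1%:R^-1.
  by rewrite normrM normrX normrN1 expr1n mul1r exp_remainder_le // normrN1.
have sS m : m.+1%:R * s m = 1 - s m.+1.
  rewrite /s mulrCA exp_remainderS mulrDr -expr2 sqrr_sign.
  by rewrite [in RHS]exprS; ring.
have s_gt0 m : 0 < s m.+1.
  rewrite -(pmulr_rgt0 _ (ltr0Sn R m.+1)) sS subr_gt0.
  apply: le_lt_trans (ler_norm _) _; apply: le_lt_trans (s_le _) _.
  by rewrite invf_lt1 ?ltr1n ?ltr0n.
apply/andP; split; first exact: s_gt0.
rewrite -/(s n.+1) -[ltRHS]div1r ltr_pdivlMr ?ltr0Sn // mulrC sS.
by have := s_gt0 n.+1; lra.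
Qed.

(** * Numerical bounds and rounding *)

Lemma invr_nat_le (R : realType) (m n : nat) : (0 < m <= n)%N ->
  n%:R^-1 <= m%:R^-1 :> R.
Proof.
by case/andP=> m_gt0 le_mn; rewrite lef_pV2 ?posrE ?ltr0n ?ler_nat //; lia.
Qed.

(** Alternation improves the denominator of [exp_remainder_le] by one, which the smallest n of the
    theorem require. *)
Lemma exp_remainderN1_lt (R : realType) n :
  `|exp_remainder (-1 : R) n.+1| < n.+2%:R^-1.
Proof.
have /andP[s_gt0 s_lt] := alternating_remainder R n.
by move: s_gt0 s_lt => /gtr0_norm <-; rewrite normrM normr_sign mul1r.
Qed.

Theorem theorem6p7 (R : realType) :
  let e : R := expR 1 in
  [/\ forall n : nat, (8 <= n)%N ->
        (alpha_xy n La La)%:Z = nearest_int ((e - 4 + 4 / e) * (n`!)%:R),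
      forall n : nat, (3 <= n)%N ->
        (alpha_xy n La Lb)%:Z = nearest_int ((1 - 2 / e) * (n`!)%:R),
      forall n : nat, (2 <= n)%N ->
        (alpha_xy n Lb Lb)%:Z = nearest_int (1 / e * (n`!)%:R)
    & forall n : nat, (4 <= n)%N ->
        (alpha n)%:Z = nearest_int ((e - 2 + 1 / e) * (n`!)%:R)].
Proof.
move=> e; have eN : expR (-1) = e^-1 by rewrite expRN.
(* Here [m] will be a numeral, so that the bounds are constants for [lra]. *)
have D_lt m n : (m < n)%N -> `|exp_remainder (-1 : R) n| < m.+2%:R^-1.
  case: n => // n le_mn; apply: lt_le_trans (exp_remainderN1_lt _ _) _.
  exact: invr_nat_le.
have E_gt0 n : (0 < n)%N -> 0 < exp_remainder (1 : R) n.
  by case: n => // n _; apply: exp_remainder1_gt0.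
have E_le m n : (m < n)%N -> exp_remainder (1 : R) n <= m.+1%:R^-1.
  case: n => // n le_mn; have := @exp_remainder_le R 1 n.
  rewrite normr1 lexx => /(_ isT); rewrite ler_norml => /andP[_ h].
  by apply: le_trans h _; apply: invr_nat_le.
(* Each rounding error combines the remainders at 1 and -1 with the coefficients of e and 1/e in the
   formula. *)
split=> n le_n; apply: nearest_int_eq.
- have [_ ->] := alpha_xy_a (leq_trans (isT : 2 <= 8)%N le_n).
  rewrite !(intrD, mulrNz, intrM, rmorph_nat) shifted_arrangementsE.
  rewrite derangementsE eN.
  set x := (X in `|X|).
  have -> : x = exp_remainder 1 n + 4 * exp_remainder (-1) n.
    by rewrite /x -?/e; ring.
  have E0 := E_gt0 n (leq_trans (isT : 1 <= 8)%N le_n).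
  have E8 := E_le 7%N n le_n.
  have D8 := D_lt 7%N n le_n.
  (* The lower bound holds since the remainder at 1 is positive and 4/9 < 1/2. *)
  rewrite ltr_norml; apply/andP; split.
    by move: D8; rewrite ltr_norml => /andP[]; lra.
  (* For odd n both remainders are positive, and the crude bounds only suffice
     from n = 11 on. *)
  have [n_even|n_odd] := boolP (~~ odd n).
    have : exp_remainder (-1 : R) n < 0.
      case: n n_even le_n {x E0 E8 D8} => // n n_even _.
      have /andP[+ _] := alternating_remainder R n.
      by rewrite -signr_odd /= n_even mulN1r oppr_gt0.
    by move: E8; lra.
  have [n_gt9|n_le9] := leqP 10 n.
    have := E_le 9%N n n_gt9; have := D_lt 9%N n n_gt9.
    by rewrite ltr_norml => /andP[]; lra.
  have -> : n = 9%N by case: (ltngtP n 8) le_n n_odd => // [|->] //; lia.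
  (* Running the recurrences back from 11 and from 10 bounds the remainders at -1 and 1 by 11/120
     and 11/100, and 44/120 + 11/100 < 1/2. *)
  have := exp_remainderS (-1 : R) 9; have := exp_remainderS (-1 : R) 10.
  have := exp_remainderS (1 : R) 9; have := E_le 9%N 10%N isT.
  have := D_lt 10%N 11%N isT; rewrite ltr_norml => /andP[].
  by rewrite !exprS expr0; lra.
- have [-> _] := alpha_xy_a (leq_trans (isT : 2 <= 3)%N le_n).
  rewrite !(intrD, mulrNz, intrM, rmorph_nat) derangementsE eN.
  set x := (X in `|X|).
  have -> : x = - (2 * exp_remainder (-1) n) by rewrite /x -?/e; ring.
  have := D_lt 2%N n le_n.
  by rewrite !ltr_norml => /andP[? ?]; apply/andP; split; lra.
- have [-> _] := alpha_xy_b le_n.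
  rewrite derangementsE eN.
  set x := (X in `|X|).
  have -> : x = exp_remainder (-1) n by rewrite /x -?/e; ring.
  by move/lt_le_trans: (D_lt 1%N n le_n); apply; apply: (@invr_nat_le R 2 3).
have n_gt1 : (2 <= n)%N by apply: leq_trans le_n.
have [aLb aLa] := alpha_xy_a n_gt1; have [bLb bLa] := alpha_xy_b n_gt1.
rewrite alpha_sum // !PoszD aLa aLb bLa bLb.
rewrite !(intrD, mulrNz, intrM, rmorph_nat) shifted_arrangementsE.
rewrite derangementsE eN.
set x := (X in `|X|).
have -> : x = exp_remainder 1 n + exp_remainder (-1) n by rewrite /x -?/e; ring.
have := E_gt0 n (leq_trans (isT : 1 <= 4)%N le_n).
have := E_le 3%N n le_n; have := D_lt 3%N n le_n.
by rewrite !ltr_norml => /andP[? ?] ? ?; apply/andP; split; lra.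
Qed.
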